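(* Let $L,M$ be locales and let $f\colon L\to M$ be an order-preserving map. Define $f_{\mathfrak o}^{\to}\colon \mathfrak o L\to\mathfrak o M$ by $f_{\mathfrak o}^{\to}(\mathfrak o(a))=\big(\mathrm{cl}(f[\mathfrak c(a)])\big)^{\mathsf c}$ and $f_{\mathfrak o}^{\leftarrow}\colon \mathfrak o M\to\mathfrak o L$ by $f_{\mathfrak o}^{\leftarrow}(\mathfrak o(b))=\mathrm{int}(f^{-1}[\mathfrak o(b)])$. Then $(f_{\mathfrak o}^{\leftarrow},f_{\mathfrak o}^{\to})$ is an adjoint pair, i.e. $f_{\mathfrak o}^{\leftarrow}\dashv f_{\mathfrak o}^{\to}$, if and only if $f$ is a localic map.
   Context: A locale (= frame) is a complete lattice $L$ with $(\bigvee A)\wedge b=\bigvee\{a\wedge b\mid a\in A\}$ for all $A\subseteq L$, $b\in L$; it has a Heyting operation $\to$ with $a\wedge b\le c\iff a\le b\to c$. A frame homomorphism preserves all joins and all finite meets (including $0$ and $1$). A localic map $f\colon L\to M$ is a right adjoint of a frame homomorphism $M\to L$. For $a\in L$: $\mathfrak c(a)=\{x\in L\mid x\ge a\}$ (closed sublocale), $\mathfrak o(a)=\{x\in L\mid a\to x=x\}$ (open sublocale). Complements $(-)^{\mathsf c}$ are taken in the lattice of sublocales, so $\mathfrak c(a)^{\mathsf c}=\mathfrak o(a)$ and $\mathfrak o(a)^{\mathsf c}=\mathfrak c(a)$. $\mathfrak o L=\{\mathfrak o(a)\mid a\in L\}$, ordered by inclusion. For any subset $S\subseteq L$, $\mathrm{cl}\,S=\mathfrak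 c(\bigwedge S)$ and $\mathrm{int}\,S=\mathfrak o(\bigvee\{a\in L\mid \mathfrak o(a)\subseteq S\})$. For posets $X,Y$, a pair $(g,h)$ of order-preserving maps $g\colon X\to Y$, $h\colon Y\to X$ is an adjoint pair, $g\dashv h$, if $g(x)\le y\iff x\le h(y)$ for all $x\in X$, $y\in Y$. *)

(* Defs.v *)
From HB Require Import structures.
From mathcomp Require Import all_boot all_order.
From mathcomp Require Import boolp classical_sets.

Set Implicit Arguments.
Unset Strict Implicit.
Unset Printing Implicit Defensive.
Import Order.LTheory.

Local Open Scope classical_set_scope.
Local Open Scope order_scope.

HB.mixin Record TBLattice_isComplete (d : Order.disp_t) L
    of Order.TBLattice d L := {
  bigjoin : set L -> L;
  bigmeet : set L -> L;
  bigjoin_sup : forall A : set L, supremums A (bigjoin A);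
  bigmeet_inf : forall A : set L, infimums A (bigmeet A)
}.

#[short(type="completeLatticeType")]
HB.structure Definition CompleteLattice (d : Order.disp_t) :=
  { L of Order.TBLattice d L & TBLattice_isComplete d L }.

HB.mixin Record CompleteLattice_isFrame (d : Order.disp_t) L
    of CompleteLattice d L := {
  bigjoin_meetl : forall (A : set L) (b : L),
    bigjoin A `&` b = bigjoin [set (a `&` b)%O | a in A]%classic
}.

#[short(type="frameType")]
HB.structure Definition Frame (d : Order.disp_t) :=
  { L of CompleteLattice d L & CompleteLattice_isFrame d L }.

Definition adjoint_pair (d d' : Order.disp_t)
    (X : porderType d) (Y : porderType d') (g : X -> Y) (h : Y -> X) : Prop :=
  [/\ {homo g : x y / x <= y}, {homo h : x y / x <= y}
    & forall (x : X) (y : Y), (g x <= y) <-> (x <= h y)].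

(* [frame_hom_join] at the empty set gives preservation of [\bot]. *)
Record frame_hom (d d' : Order.disp_t) (M : frameType d) (L : frameType d')
    (h : M -> L) : Prop := FrameHom {
  frame_hom_join : forall A : set M, h (bigjoin A) = bigjoin (h @` A)%classic;
  frame_hom_top : h \top = \top;
  frame_hom_meet : forall x y : M, h (x `&` y) = h x `&` h y
}.

Definition localic_map (d d' : Order.disp_t)
    (L : frameType d) (M : frameType d') (f : L -> M) : Prop :=
  exists h : M -> L, frame_hom h /\ adjoint_pair h f.

Section Sublocales.
Context {d : Order.disp_t} {L : frameType d}.
Implicit Types (a b c x y : L) (S T U : set L).

Definition heyting a b : L := bigjoin [set c | (a `&` c <= b)%O]%classic.

Definition sublocale S : Prop :=
  (forall A : set L, (A `<=` S)%classic -> S (bigmeet A)) /\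
  (forall x s, S s -> S (heyting x s)).

Definition closed_sloc a : set L := [set x | (a <= x)%O]%classic.

Definition open_sloc a : set L := [set x | heyting a x = x]%classic.

(* In the lattice of sublocales ordered by inclusion, binary meets are
   intersections, the bottom is [set \top], the top is [setT], and the join of
   S and T is the smallest sublocale containing both. *)
Definition sloc_complement S T : Prop :=
  [/\ sublocale S, sublocale T,
      (S `&` T)%classic = [set \top]%classic
    & smallest sublocale (S `|` T)%classic = setT].

(* The complement of S; by convention [set0], which is not a sublocale, when S
   is not complemented. *)
Definition sloc_compl S : set L :=
  xget set0%classic [set T | sloc_complement S T]%classic.

Definition sloc_cl S : set L := closed_sloc (bigmeet S).

Definition sloc_int S : set L :=
  open_sloc (bigjoin [set a | open_sloc a `<=` S]%classic).

Lemma bigjoin_ub (A : set L) x : A x -> x <= bigjoin A.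
Proof. by case: (bigjoin_sup A) => h _; exact: h. Qed.

Lemma bigjoin_le (A : set L) y : (forall x, A x -> x <= y) -> bigjoin A <= y.
Proof. by case: (bigjoin_sup A) => _ h /h. Qed.

Lemma bigmeet_lb (A : set L) x : A x -> bigmeet A <= x.
Proof. by case: (bigmeet_inf A) => h _; exact: h. Qed.

Lemma bigmeet_ge (A : set L) y : (forall x, A x -> y <= x) -> y <= bigmeet A.
Proof. by case: (bigmeet_inf A) => _ h /h. Qed.

Lemma heytingP a b c : (a `&` b <= c) = (b <= heyting a c).
Proof.
apply/idP/idP => [abc|bac]; first exact: bigjoin_ub.
apply: (le_trans (leI2 (lexx a) bac)).
rewrite meetC /heyting bigjoin_meetl; apply: bigjoin_le => _ [x /= axc <-].
by rewrite meetC.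
Qed.

Lemma heyting_mp a b : a `&` heyting a b <= b.
Proof. by rewrite heytingP. Qed.

Lemma le_heyting a b : b <= heyting a b.
Proof. by rewrite -heytingP leIr. Qed.

Lemma heyting_top a b : a <= b -> heyting a b = \top.
Proof. by move=> ab; apply/eqP; rewrite -le1x -heytingP meetx1. Qed.

Lemma heyting_meet a b c : heyting a (heyting b c) = heyting (a `&` b) c.
Proof.
apply: le_anti; apply/andP; split.
  by rewrite -heytingP [a `&` b]meetC -meetA heytingP heytingP.
by rewrite -heytingP -heytingP meetA [b `&` a]meetC heytingP.
Qed.

Lemma heytingC a b c : heyting a (heyting b c) = heyting b (heyting a c).
Proof. by rewrite !heyting_meet meetC. Qed.

Lemma heyting_idem a b : heyting a (heyting a b) = heyting a b.
Proof. by rewrite heyting_meet meetxx. Qed.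

Lemma heyting_le2 a b c : b <= c -> heyting a b <= heyting a c.
Proof. by move=> bc; rewrite -heytingP (le_trans (heyting_mp _ _)). Qed.

Lemma heyting_bigmeet a (A : set L) :
  heyting a (bigmeet A) = bigmeet [set heyting a x | x in A]%classic.
Proof.
apply: le_anti; apply/andP; split.
  by apply: bigmeet_ge => _ [x Ax <-]; exact/heyting_le2/bigmeet_lb.
rewrite -heytingP; apply: bigmeet_ge => x Ax; rewrite heytingP.
by apply: bigmeet_lb; exists x.
Qed.

Lemma sublocale_top S : sublocale S -> S \top.
Proof.
case=> Sm _; have <- : bigmeet set0 = \top :> L.
  by apply/eqP; rewrite -le1x; apply: bigmeet_ge.
exact: Sm.
Qed.

Lemma sublocale_closed a : sublocale (closed_sloc a).
Proof.
split=> [A Aa|x s /= sa]; first by apply: bigmeet_ge => x /Aa.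
exact: le_trans sa (le_heyting _ _).
Qed.

Lemma sublocale_open a : sublocale (open_sloc a).
Proof.
split=> [A Aa|x s /= sa]; last by rewrite /open_sloc /= heytingC sa.
rewrite /open_sloc /= heyting_bigmeet; congr bigmeet.
rewrite predeqE => y; split=> [[x Ax <-]|Ay]; first by rewrite (Aa x).
by exists y => //; exact: Aa.
Qed.

Lemma closed_open_complement a :
  sloc_complement (closed_sloc a) (open_sloc a).
Proof.
split; [exact: sublocale_closed|exact: sublocale_open| |].
  rewrite predeqE => x; split=> [[/= ax <-]|->]; first exact: heyting_top.
  by split; rewrite /closed_sloc /open_sloc /= ?lex1 // heyting_top ?lex1.
rewrite predeqE => x; split=> // _ U /= [[Um Uh] sU].
have -> : x = bigmeet [set (a `|` x)%O; heyting a x]%classic.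
  apply: le_anti; apply/andP; split.
    by apply: bigmeet_ge => _ [->|->]; rewrite ?leUr // le_heyting.
  set m := bigmeet _.
  have m1 : m <= a `|` x by apply: bigmeet_lb; left.
  have m2 : m <= heyting a x by apply: bigmeet_lb; right.
  have : a `|` x <= heyting m x.
    rewrite leUx le_heyting andbT -heytingP meetC.
    exact: le_trans (leI2 (lexx _) m2) (heyting_mp _ _).
  by move=> /(le_trans m1); rewrite -heytingP meetxx.
apply: Um => _ [->|->]; apply: sU; first by left; exact: leUl.
by right; exact: heyting_idem.
Qed.

Lemma closed_complement_unique a T :
  sloc_complement (closed_sloc a) T -> T = open_sloc a.
Proof.
case=> _ Tsub cT1 cTT.
have [Tm Th] := Tsub.
rewrite predeqE => t; split=> [Tt|ot].
  rewrite /open_sloc /=; apply: le_anti; rewrite le_heyting andbT.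
  have : (closed_sloc a `&` T)%classic (heyting (heyting a t) t).
    split; last exact: Th.
    by rewrite /closed_sloc /= -heytingP meetC heyting_mp.
  by rewrite cT1 /= -{2}[heyting a t]meetx1 heytingP => ->.
rewrite -ot.
suff : (smallest sublocale (closed_sloc a `|` T))%classic t.
  move=> /(_ [set x | T (heyting a x)]%classic); apply.
  split=> [|x [/= ax|Tx] /=]; last exact: Th.
    split=> [A AT|x s Ts] /=; last by rewrite heytingC; exact: Th.
    by rewrite heyting_bigmeet; apply: Tm => _ [x /AT Tx <-].
  by rewrite heyting_top //; exact: sublocale_top.
by rewrite cTT.
Qed.

Lemma sloc_compl_closed a : sloc_compl (closed_sloc a) = open_sloc a.
Proof.
rewrite /sloc_compl; case: xgetP => [T _ /closed_complement_unique //|].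
by move=> /(_ _ (closed_open_complement a)).
Qed.

Lemma open_sloc_le a b : (open_sloc a `<=` open_sloc b)%classic -> a <= b.
Proof.
move=> /(_ (heyting a b) (heyting_idem a b)) /= E.
by rewrite -[a]meetx1 heytingP -E heyting_top // le_heyting.
Qed.

Lemma open_sloc_inj : injective open_sloc.
Proof.
by move=> a b E; apply: le_anti; rewrite !open_sloc_le // E.
Qed.

Lemma sloc_compl_cl_open S : sloc_compl (sloc_cl S) \in range open_sloc.
Proof. by rewrite inE /sloc_cl sloc_compl_closed; exists (bigmeet S). Qed.

Lemma sloc_int_open S : sloc_int S \in range open_sloc.
Proof. by rewrite inE; eexists. Qed.

End Sublocales.

Definition opens (d : Order.disp_t) (L : frameType d) : Type :=
  set_type (range (@open_sloc d L)).

HB.instance Definition _ (d : Order.disp_t) (L : frameType d) :=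
  SubChoice.on (opens L).
HB.instance Definition _ (d : Order.disp_t) (L : frameType d) :=
  [SubChoice_isSubPOrder of opens L by <: with set_display].

Section Opens.
Context {d : Order.disp_t} {L : frameType d}.

Definition to_opens (a : L) : opens L :=
  exist _ (open_sloc a) (image_f _ (in_setT a)).

Lemma opens_le (U V : opens L) : (U <= V) <-> (val U `<=` val V)%classic.
Proof. by rewrite -subsetEset. Qed.

Lemma opens_surj (U : opens L) : exists a, open_sloc a = val U.
Proof. by case: U => U /= /set_mem [a _ <-]; exists a. Qed.

(* The element a, unique by [open_sloc_inj], with U = open_sloc a. *)
Definition opens_idx (U : opens L) : L := projT1 (cid (opens_surj U)).

Lemma to_opensK : cancel to_opens opens_idx.
Proof.
by move=> a; rewrite /opens_idx; case: cid => b /= /open_sloc_inj.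
Qed.

Lemma opens_idxK : cancel opens_idx to_opens.
Proof. by move=> U; apply: val_inj; rewrite /= /opens_idx; case: cid. Qed.

End Opens.

Section OpenImages.
Context {d d' : Order.disp_t} {L : frameType d} {M : frameType d'}.
Variable f : L -> M.

Definition open_push (U : opens L) : opens M :=
  exist _ (sloc_compl (sloc_cl (f @` closed_sloc (opens_idx U))))
    (sloc_compl_cl_open _).

Definition open_pull (V : opens M) : opens L :=
  exist _ (sloc_int (f @^-1` val V)) (sloc_int_open _).

Lemma open_pushE (a : L) :
  val (open_push (to_opens a)) = sloc_compl (sloc_cl (f @` closed_sloc a)).
Proof. by rewrite /= to_opensK. Qed.

Lemma open_pullE (b : M) :
  val (open_pull (to_opens b)) = sloc_int (f @^-1` open_sloc b).
Proof. by []. Qed.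

End OpenImages.

(* Main.v *)
Require Import Defs.
From mathcomp Require Import all_boot all_order.
From mathcomp Require Import boolp classical_sets.

(** For monotone [f], [cl f[c(a)] = c(f a)], so under [a <-> o(a)] the map
    [open_push f] is [f] itself, while [open_pull f] is
    [h b = \/ {a | o(a) <= f^-1[o(b)]}].  If [f] has a frame homomorphism [h'] as
    left adjoint, then [b -> f x = f (h' b -> x)] gives
    [o(a) <= f^-1[o(b)] <-> a <= h' b], hence [h = h'].  Conversely, if [h] is
    left adjoint to [f], then [f] preserves meets, so [f] maps [o(h b)] into
    [o(b)].  The element [y = (h b /\ h c) -> h (b /\ c)] lies in both [o(h b)]
    and [o(h c)], so [f y = (b /\ c) -> f y = \top], whence [y = \top]. *)

Import Order.LTheory.
Local Open Scope classical_set_scope.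
Local Open Scope order_scope.

Lemma bigmeet_image_closed_sloc {d d' : Order.disp_t} {L : frameType d}
    {M : frameType d'} (f : L -> M) (a : L) :
  {homo f : x y / x <= y} -> bigmeet (f @` closed_sloc a) = f a.
Proof.
move=> f_mono; apply: le_anti; apply/andP; split.
  by apply: bigmeet_lb; exists a => //; exact: lexx.
by apply: bigmeet_ge => _ [x ax <-]; exact: f_mono.
Qed.

Lemma open_sloc_sub {d : Order.disp_t} {L : frameType d} (a b : L) :
  (open_sloc a `<=` open_sloc b) <-> a <= b.
Proof.
split=> [|ab x xa]; first exact: open_sloc_le.
apply: le_anti; rewrite le_heyting andbT -{2}xa -heytingP.
exact: le_trans (leI2 ab (lexx _)) (heyting_mp _ _).
Qed.

Lemma to_opens_le {d : Order.disp_t} {L : frameType d} (a b : L) :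
  (to_opens a <= to_opens b) <-> a <= b.
Proof. by rewrite opens_le; exact: open_sloc_sub. Qed.

Lemma heyting_bigjoin {d : Order.disp_t} {L : frameType d} (A : set L) (x : L) :
  heyting (bigjoin A) x = bigmeet [set heyting a x | a in A].
Proof.
apply: le_anti; apply/andP; split.
  apply: bigmeet_ge => _ [a Aa <-]; rewrite -heytingP.
  by apply: le_trans (leI2 (bigjoin_ub Aa) (lexx _)) (heyting_mp _ _).
rewrite -heytingP bigjoin_meetl; apply: bigjoin_le => _ [a Aa <-].
by rewrite heytingP; apply: bigmeet_lb; exists a.
Qed.

Definition pull_idx {d d' : Order.disp_t} {L : frameType d} {M : frameType d'}
    (f : L -> M) (b : M) : L :=
  bigjoin [set a | open_sloc a `<=` f @^-1` open_sloc b].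

Lemma open_push_to_opens {d d' : Order.disp_t} {L : frameType d}
    {M : frameType d'} (f : L -> M) (a : L) :
  {homo f : x y / x <= y} -> open_push f (to_opens a) = to_opens (f a).
Proof.
move=> f_mono; apply: val_inj.
by rewrite open_pushE /sloc_cl sloc_compl_closed bigmeet_image_closed_sloc.
Qed.

Lemma open_pull_to_opens {d d' : Order.disp_t} {L : frameType d}
    {M : frameType d'} (f : L -> M) (b : M) :
  open_pull f (to_opens b) = to_opens (pull_idx f b).
Proof. exact: val_inj. Qed.

Lemma adjoint_pair_of_iff {d d' : Order.disp_t} {X : porderType d}
    {Y : porderType d'} (g : X -> Y) (h : Y -> X) :
  (forall x y, (g x <= y) <-> (x <= h y)) -> adjoint_pair g h.
Proof.
move=> gh; split=> // [x y xy|x y xy]; last first.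
  by apply/gh; apply: le_trans xy; apply/gh; exact: lexx.
by apply/gh; apply: le_trans xy _; apply/gh; exact: lexx.
Qed.

Lemma adjoint_open_idx {d d' : Order.disp_t} {L : frameType d}
    {M : frameType d'} (f : L -> M) :
  {homo f : x y / x <= y} ->
  adjoint_pair (open_pull f) (open_push f) <-> adjoint_pair (pull_idx f) f.
Proof.
move=> f_mono; split=> -[_ _ adj]; apply: adjoint_pair_of_iff.
  move=> b a; rewrite -to_opens_le -open_pull_to_opens adj.
  by rewrite open_push_to_opens // to_opens_le.
move=> V U; rewrite -(opens_idxK V) -(opens_idxK U).
by rewrite open_pull_to_opens open_push_to_opens // !to_opens_le.
Qed.

Section Adjoint.
Context {d d' : Order.disp_t} {L : frameType d} {M : frameType d'}.
Variables (h : M -> L) (f : L -> M).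
Hypothesis adj : adjoint_pair h f.

Lemma right_adjoint_bigmeet (A : set L) : f (bigmeet A) = bigmeet (f @` A).
Proof.
have [_ f_mono hf] := adj; apply: le_anti; apply/andP; split.
  by apply: bigmeet_ge => _ [x Ax <-]; apply: f_mono; exact: bigmeet_lb.
apply/hf; apply: bigmeet_ge => x Ax; apply/hf.
by apply: bigmeet_lb; exists x.
Qed.

Lemma left_adjoint_bigjoin (A : set M) : h (bigjoin A) = bigjoin (h @` A).
Proof.
have [h_mono _ hf] := adj; apply: le_anti; apply/andP; split.
  apply/hf; apply: bigjoin_le => x Ax; apply/hf.
  by apply: bigjoin_ub; exists x.
by apply: bigjoin_le => _ [x Ax <-]; apply: h_mono; exact: bigjoin_ub.
Qed.

(** Both sides have the same lower bounds: [c] lies below either one exactly when [h b] meet [h c]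
    lies below [x]. *)
Lemma heyting_right_adjoint (b : M) (x : L) :
  {morph h : b c / b `&` c} -> heyting b (f x) = f (heyting (h b) x).
Proof.
have [_ _ hf] := adj => hI; apply: le_anti; apply/andP; split.
  by apply/hf; rewrite -heytingP -hI; apply/hf; exact: heyting_mp.
by rewrite -heytingP; apply/hf; rewrite hI heytingP; apply/hf; exact: lexx.
Qed.

Lemma frame_hom_pull_idx : frame_hom h -> pull_idx f = h.
Proof.
have [_ _ hf] := adj => -[_ h1 hI]; apply/funext => b.
apply: le_anti; apply/andP; split.
  (* Test the inclusion at [heyting a (h b)], a point of [open_sloc a]. Its image lies in
     [open_sloc b], so it equals [f (heyting a \top)], which is [\top]; by adjunction and [h1],
     [a <= h b]. *)
  apply: bigjoin_le => a /= /(_ (heyting a (h b)) (heyting_idem _ _)).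
  rewrite /open_sloc /= heyting_right_adjoint // heytingC.
  rewrite [heyting (h b) (h b)]heyting_top // => E.
  have : h \top <= heyting a (h b).
    apply/hf; rewrite -E heyting_top ?lex1 //; apply/hf.
    exact: lex1.
  by rewrite h1 -heytingP meetx1.
apply: bigjoin_ub => x hbx.
by rewrite /open_sloc /= heyting_right_adjoint // hbx.
Qed.

End Adjoint.

(** The join defining [pull_idx f b] belongs to its own set: by [heyting_bigjoin] a point of its
    open sublocale is a meet of points that [f] sends into [open_sloc b], [f] preserves meets, and
    [open_sloc b] is closed under them. *)
Lemma pull_idx_sub {d d' : Order.disp_t} {L : frameType d}
    {M : frameType d'} (f : L -> M) (b : M) :
  adjoint_pair (pull_idx f) f ->
  open_sloc (pull_idx f b) `<=` f @^-1` open_sloc b.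
Proof.
move=> adj x; rewrite {1}/open_sloc /= heyting_bigjoin => <-.
rewrite (right_adjoint_bigmeet _ _ adj).
have [om _] := sublocale_open b.
by apply: om => _ [_ [a ab <-] <-]; apply: ab; exact: heyting_idem.
Qed.

Lemma frame_hom_of_adjoint {d d' : Order.disp_t} {L : frameType d}
    {M : frameType d'} (f : L -> M) :
  adjoint_pair (pull_idx f) f -> frame_hom (pull_idx f).
Proof.
move=> adj; have [h_mono f_mono hf] := adj.
have h1 : pull_idx f \top = \top.
  (* [open_sloc \top] is all of [M], so [\top] is one of the joined elements. *)
  apply: le_anti; rewrite lex1 andTb; apply: bigjoin_ub => x _.
  by apply: le_anti; rewrite le_heyting andbT -{1}[heyting _ _]meet1x heyting_mp.
split=> //; first exact: left_adjoint_bigjoin adj.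
move=> b c; apply: le_anti; apply/andP; split.
  by rewrite lexI !h_mono ?leIl ?leIr.
set x := pull_idx f (b `&` c).
(* The remaining inequality amounts to [y = \top]. *)
set y := heyting (pull_idx f b `&` pull_idx f c) x.
have yb : heyting b (f y) = f y.
  by apply: pull_idx_sub => //; rewrite /open_sloc /= /y heyting_meet meetA meetxx.
have yc : heyting c (f y) = f y.
  apply: pull_idx_sub => //.
  by rewrite /open_sloc /= /y heyting_meet meetCA meetxx.
have bcy : b `&` c <= f y by apply/hf; exact: le_heyting.
have fy1 : f y = \top by rewrite -yb -{1}yc heyting_meet heyting_top.
have : pull_idx f \top <= y by apply/hf; rewrite fy1.
by rewrite h1 -heytingP meetx1.
Qed.

Theorem theorem3p2p7 (d d' : Order.disp_t) (L : frameType d) (M : frameType d')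
    (f : L -> M) (f_mono : {homo f : x y / (x <= y)%O}) :
  adjoint_pair (open_pull f) (open_push f) <-> localic_map f.
Proof.
rewrite adjoint_open_idx //; split=> [adj|[h [h_hom adj]]].
  by exists (pull_idx f); split; first exact: frame_hom_of_adjoint.
by rewrite (frame_hom_pull_idx _ _ adj h_hom).
Qed.
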